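(* Let $M$ be a commutative monoid and $\mathcal{A}\in\mathcal{H}(M)$ a system of abelian groups over $M$. There are isomorphisms $$\pi_0(\mathsf{Coext}(M,\mathcal{A}))\simeq\mathsf{D}^1(M,\mathcal{A})\qquad\text{and}\qquad\pi_1(\mathsf{Coext}(M,\mathcal{A}))\simeq\mathsf{D}^0(M,\mathcal{A}).$$ Moreover, the split coextension (the semidirect product $M\ltimes\mathcal{A}$) corresponds to $f=0$, i.e. to the zero class in $\mathsf{D}^1(M,\mathcal{A})$.
   Context: **Systems.** All monoids are commutative, written multiplicatively with unit $1$. A system of abelian groups $\mathcal{A}$ over $M$ consists of an abelian group $\mathcal{A}(a)$ for each $a\in M$ and homomorphisms $r_*:\mathcal{A}(a)\to\mathcal{A}(ra)$ for all $r,a\in M$ with $1_*=\mathrm{id}$ and $(rs)_*=r_*\circ s_*$. Morphisms are families of homomorphisms commuting with all $r_*$; the category is $\mathcal{H}(M)$. **Coextensions.** A coextension $0\to\mathcal{A}\to N\xrightarrow{\pi}M\to0$ of $M$ by $\mathcal{A}$ is a surjective monoid homomorphism $\pi:N\to M$ with an action $\bullet$ of the group $\mathcal{A}(m)$ on $\pi^{-1}(m)$ for each $m\in M$ such that (i) for $n,n'\in\pi^{-1}(m)$ there is a unique $x\in\mathcal{A}(m)$ with $n'=x\bullet n$; (ii) $(x\bullet n)(y\bullet n')=(m'_*(x)+m_*(y))\bullet(nn')$ for $x\in\mathcal{A}(m)$, $n\in\pi^{-1}(m)$, $y\in\mathcal{A}(m')$, $n'\in\pi^{-1}(m')$. $\mathsf{Coext}(M,\mathcal{A})$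 is the groupoid of coextensions of $M$ by $\mathcal{A}$, a morphism from $\pi:N\to M$ to $\pi':N'\to M$ being a monoid homomorphism $h:N\to N'$ with $\pi'h=\pi$ and $h(x\bullet n)=x\bullet h(n)$. The semidirect product $M\ltimes\mathcal{A}=\{(a,x)\mid a\in M,x\in\mathcal{A}(a)\}$ with $(a,x)(a',x')=(aa',a_*x'+a'_*x)$, projection $(a,x)\mapsto a$ and action $z\bullet(a,x)=(a,z+x)$ is a coextension of $M$ by $\mathcal{A}$. **Group structures.** $\pi_0(\mathsf{Coext}(M,\mathcal{A}))$ is the set of isomorphism classes, an abelian group under the Baer sum: the Baer sum of $\pi:N\to M$ and $\pi':N'\to M$ is the quotient of the set of triples $(y,n,n')$ with $\pi(n)=\pi'(n')=m$, $y\in\mathcal{A}(m)$, by $(y,n,n')\sim(y-x-x',x\bullet n,x'\bullet n')$ for $x,x'\in\mathcal{A}(m)$, with multiplication $[y,n,n'][z,k,k']=[\pi(k)_*y+\pi(n)_*z,nk,n'k']$ and action $u\bullet[y,n,n']=[u+y,n,n']$. $\pi_1(\mathsf{Coext}(M,\mathcal{A})):=\mathrm{Aut}(M\ltimes\mathcal{A})$, the automorphism group in $\mathsf{Coext}(M,\mathcal{A})$. **Grillet cohomology.** $\mathsf{C}^0(M,\mathcal{A})$ is the group of functions $g$ with $g(a)\in\mathcal{A}(a)$; $\mathsf{C}^1(M,\mathcal{A})$ the group of functions $f$ with $f(a,b)\in\mathcal{A}(ab)$, $f(a,b)=f(b,a)$; $\mathsf{C}^2(M,\mathcal{A})$ the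 group of functions $h$ with $h(a,b,c)\in\mathcal{A}(abc)$, $h(a,b,c)-h(b,a,c)+h(b,c,a)=0$. The coboundaries are $$(\partial^0g)(a,b)=a_*g(b)-g(ab)+b_*g(a),\qquad(\partial^1f)(a,b,c)=a_*f(b,c)-f(ab,c)+f(a,bc)-c_*f(a,b).$$ $\mathsf{D}^0(M,\mathcal{A})=\ker\partial^0$ and $\mathsf{D}^1(M,\mathcal{A})=\ker\partial^1/\mathrm{im}\,\partial^0$. *)

(* Defs.v *)
From HB Require Import structures.
From mathcomp Require Import all_boot all_algebra.
From mathcomp Require Import boolp.

Set Implicit Arguments.
Unset Strict Implicit.
Unset Printing Implicit Defensive.

Import GRing.Theory.

Local Open Scope ring_scope.
Local Open Scope group_scope.
Local Open Scope quotient_scope.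

(* As every MathComp structure, a [comMonoidType] carries a choice operator;
   classically ([gen_choiceMixin]) this is no restriction on the monoid. *)
HB.mixin Record Monoid_isCommutative M of Monoid M := {
  mulmC : commutative (@monoid.mul M)
}.

#[short(type="comMonoidType")]
HB.structure Definition ComMonoid := {M of Monoid_isCommutative M & Monoid M}.

Bind Scope group_scope with ComMonoid.sort.

(* Dependent product of abelian groups, with the pointwise operations. *)
Section Products.
Variables (I : Type) (V : I -> zmodType).

Definition dprod := forall i, V i.
Implicit Types f g h : dprod.

HB.instance Definition _ := gen_eqMixin dprod.
HB.instance Definition _ := gen_choiceMixin dprod.

Definition dprod_zero : dprod := fun=> 0.
Definition dprod_opp f : dprod := fun i => - f i.
Definition dprod_add f g : dprod := fun i => f i + g i.

Lemma dprod_addA : associative dprod_add.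
Proof. by move=> f g h; apply: functional_extensionality_dep => i; apply: addrA. Qed.
Lemma dprod_addC : commutative dprod_add.
Proof. by move=> f g; apply: functional_extensionality_dep => i; apply: addrC. Qed.
Lemma dprod_add0 : left_id dprod_zero dprod_add.
Proof. by move=> f; apply: functional_extensionality_dep => i; apply: add0r. Qed.
Lemma dprod_addN : left_inverse dprod_zero dprod_opp dprod_add.
Proof. by move=> f; apply: functional_extensionality_dep => i; apply: addNr. Qed.

HB.instance Definition _ :=
  GRing.isZmodule.Build dprod dprod_addA dprod_addC dprod_add0 dprod_addN.

End Products.

Section Kernels.
Variables (U V : zmodType) (f : {additive U -> V}).

Definition ker_pred : {pred U} := [pred x | f x == 0].

Lemma ker_pred_closed : zmod_closed ker_pred.
Proof.
by split=> [|x y]; rewrite !inE ?raddf0 // => /eqP fx /eqP fy;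
  rewrite raddfB fx fy subrr.
Qed.
HB.instance Definition _ := GRing.isZmodClosed.Build U ker_pred ker_pred_closed.

Record ker := Ker { ker_val : U; ker_valP : ker_val \in ker_pred }.
HB.instance Definition _ := [isSub for ker_val].
HB.instance Definition _ := [Choice of ker by <:].
HB.instance Definition _ := [SubChoice_isSubZmodule of ker by <:].

End Kernels.

Section Systems.
Variable M : comMonoidType.
Implicit Types a b c r s : M.

Definition cast (T : Type) (P : T -> zmodType) (a b : T) (e : a = b) (x : P a) :
    P b := eq_rect a P x b e.

Record system := System {
  sys_grp :> M -> zmodType;
  sys_map : forall r a, {additive sys_grp a -> sys_grp (r * a)%g};
  sys_map1 : forall a x, sys_map 1 a x = cast (esym (mul1g a)) x;
  sys_mapM : forall r s a x,
    sys_map (r * s) a x = cast (mulgA r s a) (sys_map r (s * a) (sys_map s a x))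
}.

Variable A : system.

(* [push r e] is [r_*], with codomain identified along [e : r * a = b]; it
   absorbs the transports between [A (r * a)] and [A b]. *)
Definition push r a b (e : r * a = b) (x : A a) : A b := cast e (sys_map A r a x).

Lemma push_is_zmod_morphism r a b (e : r * a = b) : zmod_morphism (push e).
Proof. by case: b / e => x y; rewrite /push /= raddfB. Qed.
HB.instance Definition _ r a b (e : r * a = b) :=
  GRing.isZmodMorphism.Build (A a) (A b) (push e) (push_is_zmod_morphism e).

Lemma cast_id a (e : a = a) (x : A a) : cast e x = x.
Proof. by rewrite (eq_irrelevance e erefl). Qed.

Lemma push_eq r r' a b (e : r * a = b) (e' : r' * a = b) x :
  r = r' -> push e x = push e' x.
Proof.
move=> rr'; case: r' / rr' e' => e'.
by rewrite (eq_irrelevance e e').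
Qed.

Lemma cast_cast a b c (e : a = b) (e' : b = c) (x : A a) :
  cast e' (cast e x) = cast (etrans e e') x.
Proof. by case: c / e'. Qed.

Lemma castE a b (e : a = b) (x : A a) :
  cast e x = push (etrans (mul1g a) e) x.
Proof. by rewrite /push sys_map1 cast_cast; congr cast; apply: eq_irrelevance. Qed.

Lemma push1 a (e : 1 * a = a) x : push e x = x.
Proof. by rewrite -{2}[x](cast_id erefl) castE; apply: push_eq. Qed.

Lemma push_compE r s a b c (e : s * a = b) (e' : r * b = c)
    (e2 : (r * s) * a = c) x : push e' (push e x) = push e2 x.
Proof.
rewrite /push; case: b / e e' => /= e'; rewrite sys_mapM cast_cast.
by congr cast; apply: eq_irrelevance.
Qed.

Lemma push_push r s a b c (e : s * a = b) (e' : r * b = c) x :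
  push e' (push e x) =
  push (etrans (esym (mulgA r s a)) (etrans (congr1 (monoid.mul r) e) e')) x.
Proof. exact: push_compE. Qed.

End Systems.

Arguments push {M} A {r a b} e x : simpl never.
Arguments push_eq {M A r} r' {a b}.

Section CastTheory.
Variables (M : comMonoidType) (A : system M).
Implicit Types a b c : M.

Lemma cast_is_zmod_morphism a b (e : a = b) : zmod_morphism (@cast M A a b e).
Proof. by case: b / e. Qed.
HB.instance Definition _ a b (e : a = b) :=
  GRing.isZmodMorphism.Build (A a) (A b) (@cast M A a b e)
    (cast_is_zmod_morphism e).

Lemma cast_push r a b c (e : r * a = b) (e' : b = c) (x : A a) :
  cast e' (push A e x) = push A (etrans e e') x.
Proof. by case: c / e'. Qed.

Lemma push_cast r a b c (e : a = b) (e' : r * b = c) (x : A a) :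
  push A e' (cast e x) = push A (etrans (congr1 (monoid.mul r) e) e') x.
Proof. by case: b / e e' => e' /=; apply: push_eq. Qed.
End CastTheory.

Section Cohomology.
Variables (M : comMonoidType) (A : system M).
Implicit Types a b c : M.

Lemma mulmBAC a b c : b * a * c = a * b * c.
Proof. by rewrite (mulmC b). Qed.

Lemma mulmBCA a b c : b * c * a = a * b * c.
Proof. by rewrite mulmC mulgA. Qed.

Definition fun2 := dprod (fun a => dprod (fun b => A (a * b))).
Definition fun3 :=
  dprod (fun a => dprod (fun b => dprod (fun c => A (a * b * c)))).
HB.instance Definition _ := GRing.Zmodule.on fun2.
HB.instance Definition _ := GRing.Zmodule.on fun3.

Definition C1_pred : {pred fun2} :=
  [pred f : fun2 | `[< forall a b, f a b = cast (mulmC b a) (f b a) >]].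

Definition C2_pred : {pred fun3} :=
  [pred h : fun3 | `[< forall a b c,
    h a b c - cast (mulmBAC a b c) (h b a c) + cast (mulmBCA a b c) (h b c a)
      = 0 >]].

Lemma sub3ACA (V : zmodType) (f g u v w z : V) :
  (f - g) - (u - v) + (w - z) = (f - u + w) - (g - v + z).
Proof. by rewrite !opprD !opprK [X in X + _ = _]addrACA [LHS]addrACA. Qed.

Lemma sub12AC (V : zmodType) (p6 f1 f3 p4 p5 f2 : V) :
  p6 - f1 + f3 - p4 + (- p5 + f1 - f2 + p4) + (p5 - f3 + f2 - p6) = 0.
Proof.
rewrite !addrA [LHS](ACl ((1*12)*(2*6)*(3*10)*(4*8)*(5*9)*(7*11)))%AC /=.
by rewrite !(subrr, addNr) !addr0.
Qed.

Lemma sub2ACA (V : zmodType) (f g u v : V) :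
  (f - g) - (u - v) = (f - u) - (g - v).
Proof. by rewrite !opprD addrACA. Qed.

Lemma sub12AC' (V : zmodType) (x1 x2 x3 x4 x5 x6 : V) :
  (x1 - x2 + x3) - (x1 - x4 + x5) + (x2 - x4 + x6) - (x3 - x5 + x6) = 0.
Proof.
rewrite !opprD !opprK !addrA.
rewrite [LHS](ACl ((1*4)*(2*7)*(3*10)*(5*8)*(6*11)*(9*12)))%AC /=.
by rewrite !(subrr, addNr) !addr0.
Qed.

Lemma C1_pred_closed : zmod_closed C1_pred.
Proof.
split=> [|f g]; rewrite !inE.
  by apply/asboolP => a b; rewrite -[RHS]/(cast _ 0) raddf0.
move=> /asboolP fP /asboolP gP; apply/asboolP => a b.
rewrite -[LHS]/(f a b - g a b) -[RHS]/(cast _ (f b a - g b a)).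
by rewrite raddfB /= -fP -gP.
Qed.
HB.instance Definition _ := GRing.isZmodClosed.Build fun2 C1_pred C1_pred_closed.

Lemma C2_pred_closed : zmod_closed C2_pred.
Proof.
split=> [|f g]; rewrite !inE.
  apply/asboolP => a b c.
  by rewrite -[LHS]/(0 - cast _ 0 + cast _ 0) !raddf0 !addr0.
move=> /asboolP fP /asboolP gP; apply/asboolP => a b c.
rewrite -[LHS]/((f a b c - g a b c) - cast _ (f b a c - g b a c)
                 + cast _ (f b c a - g b c a)).
by rewrite !(raddfB (cast _)) /= sub3ACA fP gP subrr.
Qed.
HB.instance Definition _ := GRing.isZmodClosed.Build fun3 C2_pred C2_pred_closed.

Definition C0 := dprod A.
HB.instance Definition _ := GRing.Zmodule.on C0.

Record C1 := MkC1 { C1_val : fun2; C1_valP : C1_val \in C1_pred }.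
HB.instance Definition _ := [isSub for C1_val].
HB.instance Definition _ := [Choice of C1 by <:].
HB.instance Definition _ := [SubChoice_isSubZmodule of C1 by <:].

Record C2 := MkC2 { C2_val : fun3; C2_valP : C2_val \in C2_pred }.
HB.instance Definition _ := [isSub for C2_val].
HB.instance Definition _ := [Choice of C2 by <:].
HB.instance Definition _ := [SubChoice_isSubZmodule of C2 by <:].

(* The proofs given to [push] and [cast] only rearrange products, so that all
   terms land in A (a * b), resp. A (a * b * c). *)
Definition d0_fun (g : C0) : fun2 := fun a b =>
  push A (erefl (a * b)) (g b) - g (a * b) + push A (mulmC b a) (g a).

Definition d1_fun (f : fun2) : fun3 := fun a b c =>
  push A (mulgA a b c) (f b c) - f (a * b) c
    + cast (mulgA a b c) (f a (b * c)) - push A (mulmC c (a * b)) (f a b).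

Lemma cast_app (g : C0) a b (e : a = b) : cast e (g a) = g b.
Proof. by case: b / e. Qed.

Lemma cast_app1 (f : fun2) a a' b (e : a * b = a' * b) :
  a = a' -> cast e (f a b) = f a' b.
Proof. by move=> aa'; case: a' / aa' e => e; rewrite cast_id. Qed.

Lemma cast_app2 (f : fun2) a b b' (e : a * b = a * b') :
  b = b' -> cast e (f a b) = f a b'.
Proof. by move=> bb'; case: b' / bb' e => e; rewrite cast_id. Qed.

Lemma d0_in g : d0_fun g \in C1_pred.
Proof.
rewrite inE; apply/asboolP => a b; rewrite /d0_fun raddfD raddfB /=.
rewrite !cast_push cast_app.
rewrite [LHS]addrAC -[LHS]addrA [RHS]addrC.
congr (_ + (_ + _)). all: exact: push_eq.
Qed.

Lemma d1_in (f : C1) : d1_fun (val f) \in C2_pred.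
Proof.
have fC : forall a b, val f a b = cast (mulmC b a) (val f b a).
  by apply/asboolP; exact: (valP f).
move: (val f) fC => {}f fC.
rewrite inE; apply/asboolP => a b c; rewrite /d1_fun.
rewrite !(raddfD, raddfB) /= !cast_push !cast_cast.
have e1 : cast (mulmBAC a b c) (f (b * a) c) = f (a * b) c.
  by rewrite cast_app1 // mulmC.
have e2 : cast (etrans (mulgA b c a) (mulmBCA a b c)) (f b (c * a))
   = cast (etrans (mulgA b a c) (mulmBAC a b c)) (f b (a * c)).
  rewrite -(cast_app2 f (congr1 (monoid.mul b) (mulmC a c)) (mulmC a c)) cast_cast.
  by congr cast; apply: eq_irrelevance.
have e3 : cast (mulmBCA a b c) (f (b * c) a) = cast (mulgA a b c) (f a (b * c)).
  by rewrite (fC a) cast_cast; congr cast; apply: eq_irrelevance.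
have e4 : push A (etrans (mulmC c (b * a)) (mulmBAC a b c)) (f b a)
  = push A (mulmC c (a * b)) (f a b).
  by rewrite (fC a b) push_cast; apply: push_eq.
have e5 : push A (etrans (mulgA b c a) (mulmBCA a b c)) (f c a)
  = push A (etrans (mulgA b a c) (mulmBAC a b c)) (f a c).
  by rewrite (fC c a) push_cast; apply: push_eq.
have e6 : push A (etrans (mulmC a (b * c)) (mulmBCA a b c)) (f b c)
   = push A (mulgA a b c) (f b c) by apply: push_eq.
rewrite !raddfN /= !cast_push e1 e2 e3 e4 e5 e6 !opprK.
exact: sub12AC.
Qed.

Definition d0 (g : C0) : C1 := MkC1 (d0_in g).
Definition d1 (f : C1) : C2 := MkC2 (d1_in f).

Lemma d0_is_zmod_morphism : zmod_morphism d0.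
Proof.
move=> g h; apply: val_inj; do 2 apply: functional_extensionality_dep => ?.
rewrite -[LHS]/(push A _ (_ - _) - (_ - _) + push A _ (_ - _)).
by rewrite !(raddfB (push A _)) sub3ACA.
Qed.
HB.instance Definition _ := GRing.isZmodMorphism.Build C0 C1 d0 d0_is_zmod_morphism.

Lemma d1_is_zmod_morphism : zmod_morphism d1.
Proof.
move=> f g; apply: val_inj; do 3 apply: functional_extensionality_dep => ?.
rewrite -[LHS]/(push A _ (_ - _) - (_ - _) + cast _ (_ - _) - push A _ (_ - _)).
rewrite !(raddfB (push A _)) !(raddfB (cast _)) sub3ACA.
exact: sub2ACA.
Qed.
HB.instance Definition _ := GRing.isZmodMorphism.Build C1 C2 d1 d1_is_zmod_morphism.

Lemma d1_d0 g : d1 (d0 g) = 0.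
Proof.
apply: val_inj; apply: functional_extensionality_dep => a.
apply: functional_extensionality_dep => b; apply: functional_extensionality_dep => c.
rewrite -[RHS]/(0 : A (a * b * c)) /= /d1_fun /d0_fun.
rewrite !(raddfD, raddfN) /= !push_push !cast_push cast_app.
set e1 := etrans _ _; set e2 := etrans _ _; set e3 := etrans _ _.
set e4 := etrans _ _; set e5 := etrans _ _; set e6 := etrans _ _.
rewrite (push_eq (a * b) e1 erefl) // (push_eq a e3 (mulgA a b c)) //.
rewrite (push_eq (a * c) e5 e2 _ (mulmC c a)) (push_eq (b * c) e6 e4 _ (mulmC c b)).
by rewrite -!opprD sub12AC'.
Qed.

Definition D0 := ker d0.
HB.instance Definition _ := GRing.Zmodule.on D0.

Definition Z1 := ker d1.
HB.instance Definition _ := GRing.Zmodule.on Z1.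

Definition B1_pred : {pred Z1} := [pred z : Z1 | `[< exists g : C0, d0 g = val z >]].

Lemma B1_pred_closed : zmod_closed B1_pred.
Proof.
split=> [|x y]; rewrite !inE.
  by apply/asboolP; exists 0; rewrite !raddf0.
move=> /asboolP[g gx] /asboolP[h hy]; apply/asboolP; exists (g - h).
by rewrite !raddfB /= gx hy.
Qed.
HB.instance Definition _ := GRing.isZmodClosed.Build Z1 B1_pred B1_pred_closed.

Definition D1 := Quotient.quot B1_pred.
HB.instance Definition _ := GRing.Zmodule.on D1.

End Cohomology.

Section Fibers.
Variables (M N : comMonoidType) (p : N -> M).

Definition fiber (m : M) := {n : N | p n == m}.

Definition Fiber m (n : N) (e : p n = m) : fiber m := exist _ n (introT eqP e).

Lemma fiberP m (n : fiber m) : p (val n) = m.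
Proof. exact/eqP/(valP n). Qed.

Lemma fiber_mul_subproof (pM : monoid.monoid_morphism p) m m'
  (n : fiber m) (n' : fiber m') : p (val n * val n') = m * m'.
Proof. by rewrite pM.2 !fiberP. Qed.

Definition fiber_mul pM m m' (n : fiber m) (n' : fiber m') : fiber (m * m') :=
  Fiber (fiber_mul_subproof pM n n').
End Fibers.

Section Coextensions.
Variables (M : comMonoidType) (A : system M).

(* The group A(m) acts on the fibre over m ([coext_act0], [coext_actD]), which
   is a torsor; m'_*(x) lies in A(m' * m), hence the [mulmC]. *)
Record coext := Coext {
  coext_mon :> comMonoidType;
  coext_pi : coext_mon -> M;
  coext_piM : monoid.monoid_morphism coext_pi;
  coext_pi_surj : forall m, exists n, coext_pi n = m;
  coext_act : forall m, A m -> fiber coext_pi m -> fiber coext_pi m;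
  coext_act0 : forall m n, @coext_act m 0 n = n;
  coext_actD : forall m x y n,
    @coext_act m (x + y) n = coext_act x (coext_act y n);
  coext_torsor : forall m (n n' : fiber coext_pi m),
    exists! x, n' = coext_act x n;
  coext_act_mul : forall m m' (x : A m) (n : fiber coext_pi m)
      (y : A m') (n' : fiber coext_pi m'),
    fiber_mul coext_piM (coext_act x n) (coext_act y n')
      = coext_act (push A (mulmC m' m) x + push A (erefl (m * m')) y)
                  (fiber_mul coext_piM n n')
}.

Notation "x • n" := (coext_act x n) (at level 42, right associativity).

Definition fiber_map (E F : coext) (h : E -> F)
    (hpi : forall n, coext_pi (h n) = coext_pi n) m
    (n : fiber (@coext_pi E) m) : fiber (@coext_pi F) m :=
  Fiber (etrans (hpi (val n)) (fiberP n)).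

Record coext_hom (E F : coext) := CoextHom {
  hom_fun :> E -> F;
  hom_mor : monoid.monoid_morphism hom_fun;
  hom_pi : forall n, coext_pi (hom_fun n) = coext_pi n;
  hom_act : forall m (x : A m) (n : fiber (@coext_pi E) m),
    hom_fun (val (x • n)) = val (x • fiber_map hom_pi n)
}.

Lemma hom_ext E F (h k : coext_hom E F) : h =1 k -> h = k.
Proof.
case: h k => [h hM hp ha] [k kM kp ka] /= /funext hk.
case: k / hk kM kp ka => kM kp ka.
case: _ / (Prop_irrelevance hM kM); case: _ / (Prop_irrelevance hp kp) ka => ka.
by case: _ / (Prop_irrelevance ha ka).
Qed.

Definition hom_id E : coext_hom E E.
Proof.
refine (@CoextHom E E idfun _ (fun=> erefl) _) => [|m x n]; first by split.
by congr (val (_ • _)); apply: val_inj.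
Defined.

Lemma hom_comp_mor E F G (k : coext_hom F G) (h : coext_hom E F) :
  monoid.monoid_morphism (k \o h).
Proof.
split=> [|x y] /=; first by rewrite (hom_mor h).1 (hom_mor k).1.
by rewrite (hom_mor h).2 (hom_mor k).2.
Qed.

Definition hom_comp E F G (k : coext_hom F G) (h : coext_hom E F) : coext_hom E G.
Proof.
refine (@CoextHom E G (k \o h) (hom_comp_mor k h)
         (fun n => etrans (hom_pi k (h n)) (hom_pi h n)) _) => m x n /=.
rewrite (hom_act h) (hom_act k).
by congr (val (_ • _)); apply: val_inj.
Defined.

Record coext_iso E F := CoextIso {
  iso_hom :> coext_hom E F;
  iso_inv : coext_hom F E;
  iso_homK : hom_comp iso_inv iso_hom = hom_id E;
  iso_invK : hom_comp iso_hom iso_inv = hom_id F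
}.

Definition isomorphic E F := inhabited (coext_iso E F).

Lemma hom_compA E F G H (l : coext_hom G H) (k : coext_hom F G) (h : coext_hom E F) :
  hom_comp l (hom_comp k h) = hom_comp (hom_comp l k) h.
Proof. exact: hom_ext. Qed.

Lemma hom_comp1 E F (h : coext_hom E F) : hom_comp h (hom_id E) = h.
Proof. exact: hom_ext. Qed.

Lemma hom_1comp E F (h : coext_hom E F) : hom_comp (hom_id F) h = h.
Proof. exact: hom_ext. Qed.

Definition iso_id E : coext_iso E E := CoextIso (hom_comp1 _) (hom_comp1 _).

Definition iso_sym E F (h : coext_iso E F) : coext_iso F E :=
  CoextIso (iso_invK h) (iso_homK h).

Definition iso_comp E F G (k : coext_iso F G) (h : coext_iso E F) : coext_iso E G.
Proof.
exists (hom_comp k h) (hom_comp (iso_inv h) (iso_inv k)).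
  by rewrite -hom_compA (hom_compA _ k) iso_homK hom_1comp iso_homK.
by rewrite -hom_compA (hom_compA _ (iso_inv h)) iso_invK hom_1comp iso_invK.
Defined.

Lemma iso_ext E F (h k : coext_iso E F) : iso_hom h = iso_hom k -> h = k.
Proof.
case: h k => [h h' hK h'K] [k k' kK k'K] /= hk; case: k / hk kK k'K => kK k'K.
have hk' : h' = k' by rewrite -(hom_comp1 h') -k'K hom_compA hK hom_1comp.
case: k' / hk' kK k'K => kK k'K.
by rewrite (Prop_irrelevance hK kK) (Prop_irrelevance h'K k'K).
Qed.

Section Aut.
Variable E : coext.

Definition Aut := coext_iso E E.
HB.instance Definition _ := gen_eqMixin Aut.
HB.instance Definition _ := gen_choiceMixin Aut.

Definition aut_mul (h k : Aut) : Aut := iso_comp h k.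
Definition aut_one : Aut := iso_id E.
Definition aut_inv (h : Aut) : Aut := iso_sym h.

Lemma aut_mulA : associative aut_mul.
Proof. by move=> h k l; apply/iso_ext/hom_compA. Qed.
Lemma aut_mul1g : left_id aut_one aut_mul.
Proof. by move=> h; apply/iso_ext/hom_1comp. Qed.
Lemma aut_mulg1 : right_id aut_one aut_mul.
Proof. by move=> h; apply/iso_ext/hom_comp1. Qed.
Lemma aut_mulVg : left_inverse aut_one aut_inv aut_mul.
Proof. by move=> h; apply/iso_ext/iso_homK. Qed.
Lemma aut_mulgV : right_inverse aut_one aut_inv aut_mul.
Proof. by move=> h; apply/iso_ext/iso_invK. Qed.

HB.instance Definition _ :=
  isGroup.Build Aut aut_mulA aut_mul1g aut_mulg1 aut_mulVg aut_mulgV.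
End Aut.

Definition sdp := {a : M & A a}.
HB.instance Definition _ := Choice.on sdp.

Definition sdp_pair a (x : A a) : sdp := existT (fun a => A a) a x.

Definition sdp_mul (u v : sdp) : sdp :=
  sdp_pair (push A (erefl (tag u * tag v)) (tagged v)
    + push A (mulmC (tag v) (tag u)) (tagged u)).
Definition sdp_one : sdp := @sdp_pair 1 (0 : A 1).

Lemma sdp_eq a b (x : A a) (y : A b) (e : a = b) :
  cast e x = y -> sdp_pair x = sdp_pair y.
Proof. by case: b / e y => y <-. Qed.

Lemma sdp_mulA : associative sdp_mul.
Proof.
move=> [a x] [b y] [c z]; rewrite /sdp_mul /=; apply: (sdp_eq (e := mulgA a b c)).
rewrite !raddfD /= !cast_push !push_push addrA.
by congr (_ + _ + _); apply: push_eq; rewrite // mulmC.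
Qed.
Lemma sdp_mulC : commutative sdp_mul.
Proof.
move=> [a x] [b y]; rewrite /sdp_mul /=; apply: (sdp_eq (e := mulmC a b)).
by rewrite !raddfD /= !cast_push addrC; congr (_ + _); apply: push_eq.
Qed.
Lemma sdp_mul1 : left_id sdp_one sdp_mul.
Proof.
move=> [a x]; rewrite /sdp_mul /=; apply: (sdp_eq (e := mul1g a)).
by rewrite !raddfD /= !cast_push !raddf0 addr0 push1.
Qed.
Lemma sdp_mul1r : right_id sdp_one sdp_mul.
Proof. by move=> u; rewrite sdp_mulC sdp_mul1. Qed.

HB.instance Definition _ := isMonoid.Build sdp sdp_mulA sdp_mul1 sdp_mul1r.
HB.instance Definition _ := Monoid_isCommutative.Build sdp sdp_mulC.

Definition sdp_pi (u : sdp) : M := tag u.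
Lemma sdp_piM : monoid.monoid_morphism sdp_pi.
Proof. by []. Qed.
Lemma sdp_pi_surj m : exists u, sdp_pi u = m.
Proof. by exists (sdp_pair (0 : A m)). Qed.

(* z • (m, x) = (m, z + x); the [cast] only identifies [tag u] with [m]. *)
Definition sdp_act m (z : A m) (u : fiber sdp_pi m) : fiber sdp_pi m :=
  Fiber (erefl : sdp_pi (sdp_pair (z + cast (fiberP u) (tagged (val u)))) = m).

Definition sdp_mk m (x : A m) : fiber sdp_pi m :=
  Fiber (erefl : sdp_pi (sdp_pair x) = m).

Lemma sdp_mkP m (u : fiber sdp_pi m) : exists x, u = sdp_mk x.
Proof.
exists (cast (fiberP u) (tagged (val u))); apply: val_inj.
case: u => -[a x] ue; move: (fiberP _) => e.
exact: (sdp_eq (e := e)).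
Qed.

Lemma sdp_actE m (z x : A m) : sdp_act z (sdp_mk x) = sdp_mk (z + x).
Proof. by rewrite /sdp_act cast_id; apply: val_inj. Qed.

Lemma sdp_mk_inj m : injective (@sdp_mk m).
Proof.
move=> x y /(congr1 val) /= e; have /= et := congr1 (@tag _ _) e.
by have /eqP := e; rewrite eq_Tagged => /eqP.
Qed.

Lemma sdp_act0 m (u : fiber sdp_pi m) : sdp_act 0 u = u.
Proof. by have [x ->] := sdp_mkP u; rewrite sdp_actE add0r. Qed.
Lemma sdp_actD m (x y : A m) (u : fiber sdp_pi m) :
  sdp_act (x + y) u = sdp_act x (sdp_act y u).
Proof. by have [z ->] := sdp_mkP u; rewrite !sdp_actE addrA. Qed.
Lemma sdp_torsor m (u v : fiber sdp_pi m) : exists! x, v = sdp_act x u.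
Proof.
have [x ->] := sdp_mkP u; have [y ->] := sdp_mkP v.
exists (y - x); split=> [|z]; rewrite sdp_actE ?subrK // => /sdp_mk_inj ->.
by rewrite addrK.
Qed.
Lemma sdp_act_mul m m' (x : A m) (u : fiber sdp_pi m)
      (y : A m') (v : fiber sdp_pi m') :
    fiber_mul sdp_piM (sdp_act x u) (sdp_act y v)
      = sdp_act (push A (mulmC m' m) x + push A (erefl (m * m')) y)
                  (fiber_mul sdp_piM u v).
Proof.
have [z ->] := sdp_mkP u; have [w ->] := sdp_mkP v.
have mE a b p q : fiber_mul sdp_piM (@sdp_mk a p) (@sdp_mk b q) =
   sdp_mk (push A (erefl (a * b)) q + push A (mulmC b a) p) by apply: val_inj.
rewrite !sdp_actE !mE sdp_actE !raddfD /=; congr sdp_mk.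
by rewrite [LHS]addrACA; congr (_ + _); apply: addrC.
Qed.

Definition semidirect : coext :=
  Coext sdp_pi_surj sdp_act0 sdp_actD sdp_torsor sdp_act_mul.

Lemma act_inj E m (n : fiber (@coext_pi E) m) (x y : A m) :
  x • n = y • n -> x = y.
Proof.
move=> xy; have [z [_ zU]] := coext_torsor n (x • n).
by rewrite -(zU x) // -(zU y).
Qed.

Lemma act_trans E m (n n' : fiber (@coext_pi E) m) : exists x, n' = x • n.
Proof. by have [x [nx _]] := coext_torsor n n'; exists x. Qed.

Section BaerSum.
Variables E F : coext.

Record triple := Triple {
  tr_base : M;
  tr_grp : A tr_base;
  tr_fst : fiber (@coext_pi E) tr_base;
  tr_snd : fiber (@coext_pi F) tr_base
}.
HB.instance Definition _ := gen_eqMixin triple.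
HB.instance Definition _ := gen_choiceMixin triple.

Definition baer_rel : rel triple := fun t t' =>
  `[< exists x x' : A (tr_base t),
        t' = Triple (tr_grp t - x - x') (x • tr_fst t) (x' • tr_snd t) >].

Lemma baer_rel_equiv : equiv_class_of baer_rel.
Proof.
have sym t t' : baer_rel t t' -> baer_rel t' t.
  case: t => m y n n' /asboolP[x [x' ->]]; apply/asboolP => /=.
  exists (- x), (- x'); rewrite -!coext_actD !addNr !coext_act0 !opprK.
  by rewrite addrAC !subrK.
split=> [t|t t'|t1 t2 t3].
- apply/asboolP; exists 0, 0; rewrite !subr0 !coext_act0.
  by case: t.
- by apply/idP/idP; apply: sym.
- case: t1 => m y n n' /asboolP /= [x [x' ->]] /asboolP /= [z [z' ->]].
  apply/asboolP; exists (z + x), (z' + x') => /=; rewrite !coext_actD.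
  congr Triple; rewrite !opprD !addrA.
  by rewrite [LHS](ACl (1*4*2*5*3))%AC.
Qed.

Canonical baer_equiv := EquivRelPack baer_rel_equiv.
Canonical baer_encModRel := defaultEncModRel baer_rel.

Definition baer_type := {eq_quot baer_rel}.
HB.instance Definition _ := Choice.on baer_type.
HB.instance Definition _ : EqQuotient triple baer_rel baer_type :=
  EqQuotient.on baer_type.

Definition baer_cls (t : triple) : baer_type := \pi_baer_type t.

Lemma baer_clsP t t' : baer_cls t = baer_cls t' <-> baer_rel t t'.
Proof. by split=> [/eqmodP|/eqmodP]. Qed.

Lemma baer_cls_surj (q : baer_type) : exists t, q = baer_cls t.
Proof. by exists (repr q); rewrite /baer_cls reprK. Qed.

Lemma tr_eq m m' y n n' z k k' (e : m = m') :
  cast e y = z -> val n = val k -> val n' = val k' ->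
  @Triple m y n n' = @Triple m' z k k'.
Proof.
case: m' / e z k k' => z k k' <- nk nk'.
by rewrite (val_inj nk) (val_inj nk').
Qed.

Definition tr_mul (t u : triple) : triple :=
  Triple (push A (mulmC (tr_base u) (tr_base t)) (tr_grp t)
            + push A (erefl (tr_base t * tr_base u)) (tr_grp u))
         (fiber_mul (@coext_piM E) (tr_fst t) (tr_fst u))
         (fiber_mul (@coext_piM F) (tr_snd t) (tr_snd u)).

Definition tr_one : triple :=
  Triple (0 : A 1) (Fiber (@coext_piM E).1) (Fiber (@coext_piM F).1).

Definition baer_mul (q r : baer_type) : baer_type :=
  baer_cls (tr_mul (repr q) (repr r)).

Lemma baer_mulE t u : baer_mul (baer_cls t) (baer_cls u) = baer_cls (tr_mul t u).
Proof.
rewrite /baer_mul; set t' := repr _; set u' := repr _.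
have : baer_rel t t' by apply/baer_clsP; rewrite /baer_cls reprK.
have : baer_rel u u' by apply/baer_clsP; rewrite /baer_cls reprK.
move: t' u' => t' u' /asboolP[x [x' ->]] /asboolP[z [z' ->]].
apply/esym/baer_clsP/asboolP; rewrite /tr_mul /= !coext_act_mul.
eexists; eexists; congr Triple.
rewrite !raddfB /= !opprD.
by rewrite !addrA [LHS](ACl (1*4*2*5*3*6))%AC.
Qed.

Lemma baer_mulA : associative baer_mul.
Proof.
move=> q r s; have [t ->] := baer_cls_surj q; have [u ->] := baer_cls_surj r.
have [v ->] := baer_cls_surj s; rewrite !baer_mulE; congr baer_cls.
apply: (tr_eq (e := mulgA (tr_base t) (tr_base u) (tr_base v))); rewrite /= ?mulgA //.
rewrite !raddfD /= !cast_push !push_push addrA.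
by congr (_ + _ + _); apply: push_eq; rewrite // mulmC.
Qed.

Lemma baer_mulC : commutative baer_mul.
Proof.
move=> q r; have [t ->] := baer_cls_surj q; have [u ->] := baer_cls_surj r.
rewrite !baer_mulE; congr baer_cls.
apply: (tr_eq (e := mulmC (tr_base t) (tr_base u))) => /=; try exact: mulmC.
by rewrite raddfD /= !cast_push addrC; congr (_ + _); apply: push_eq.
Qed.

Lemma baer_mul1 : left_id (baer_cls tr_one) baer_mul.
Proof.
move=> q; have [t ->] := baer_cls_surj q.
rewrite baer_mulE; congr baer_cls; rewrite /tr_mul /=.
case: t => m y n n' /=.
apply: (tr_eq (e := mul1g m)); rewrite /= ?mul1g //.
by rewrite raddfD /= !cast_push raddf0 add0r push1.
Qed.

Lemma baer_mulr1 : right_id (baer_cls tr_one) baer_mul.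
Proof. by move=> q; rewrite baer_mulC baer_mul1. Qed.

HB.instance Definition _ := isMonoid.Build baer_type baer_mulA baer_mul1 baer_mulr1.
HB.instance Definition _ := Monoid_isCommutative.Build baer_type baer_mulC.

Definition baer_pi (q : baer_type) : M := tr_base (repr q).

Lemma baer_piE t : baer_pi (baer_cls t) = tr_base t.
Proof.
rewrite /baer_pi; set t' := repr _.
have /asboolP[x [x' ->]] : baer_rel t t' by apply/baer_clsP; rewrite /baer_cls reprK.
by [].
Qed.

Lemma baer_piM : monoid.monoid_morphism baer_pi.
Proof.
split=> [|q r]; first exact: baer_piE.
have [t ->] := baer_cls_surj q; have [u ->] := baer_cls_surj r.
by rewrite [_ * _]baer_mulE !baer_piE.
Qed.

Lemma baer_pi_surj m : exists q, baer_pi q = m.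
Proof.
have [n nE] := coext_pi_surj E m; have [k kE] := coext_pi_surj F m.
by exists (baer_cls (Triple (0 : A m) (Fiber nE) (Fiber kE))); rewrite baer_piE.
Qed.

Definition baer_mk m (y : A m) n n' : fiber baer_pi m :=
  Fiber (baer_piE (@Triple m y n n')).

Lemma baer_mkP m (q : fiber baer_pi m) : exists y n n', q = @baer_mk m y n n'.
Proof.
case: q => q qm; have [t qt] := baer_cls_surj q.
have tm : tr_base t = m by rewrite -(eqP qm) qt baer_piE.
case: t tm qt => m' y n n' /= tm; case: m / tm qm => qm qt.
by exists y, n, n'; apply: val_inj; rewrite /= qt.
Qed.

(* u • (y, n, n') = (u + y, n, n'), on a triple over a base equal to [m]. *)
Definition tr_act m (u : A m) (t : triple) (e : tr_base t = m) : triple :=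
  Triple (cast (esym e) u + tr_grp t) (tr_fst t) (tr_snd t).

Lemma baer_act_subproof m (u : A m) (q : fiber baer_pi m) :
  baer_pi (baer_cls (@tr_act m u (repr (val q)) (fiberP q))) = m.
Proof. by rewrite baer_piE; exact: fiberP q. Qed.

Definition baer_act m (u : A m) (q : fiber baer_pi m) : fiber baer_pi m :=
  Fiber (baer_act_subproof u q).

Lemma baer_mk_eq m (y z : A m) n n' k k' :
  baer_mk y n n' = baer_mk z k k' <->
  exists x x', [/\ z = y - x - x', k = x • n & k' = x' • n'].
Proof.
split=> [/(congr1 val) /= /baer_clsP /asboolP /= [x [x' e]]|[x [x' [-> -> ->]]]].
  exists x, x'.
  pose f (t : triple) (et : tr_base t = m) : A m * fiber (@coext_pi E) m * fiber (@coext_pi F) m :=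
    eq_rect _ (fun m => (A m * fiber (@coext_pi E) m * fiber (@coext_pi F) m)%type)
      (tr_grp t, tr_fst t, tr_snd t) _ et.
  have fE t t' et et' : t = t' -> f t et = f t' et'.
    by move=> tt; case: t' / tt et' => et'; rewrite (eq_irrelevance et et').
  have := fE (Triple z k k') (Triple (y - x - x') (x • n) (x' • n')) erefl erefl e.
  by case.
apply: val_inj; apply/baer_clsP/asboolP; exists x, x'; by [].
Qed.

Lemma baer_actE m (u y : A m) n n' :
  baer_act u (baer_mk y n n') = baer_mk (u + y) n n'.
Proof.
apply: val_inj; rewrite [LHS]/=; move: (fiberP _); rewrite {1}/baer_pi; set t := repr _ => e.
have : baer_rel (Triple y n n') t by apply/baer_clsP; rewrite /baer_cls reprK.
move: t e => t e /asboolP[x [x' /esym tE]]; case: t / tE e => /= e.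
rewrite /tr_act cast_id; apply/esym/baer_clsP/asboolP; exists x, x' => /=.
by rewrite !addrA.
Qed.

Lemma baer_act0 m (q : fiber baer_pi m) : baer_act 0 q = q.
Proof. by have [y [n [n' ->]]] := baer_mkP q; rewrite baer_actE add0r. Qed.

Lemma baer_actD m (x y : A m) (q : fiber baer_pi m) :
  baer_act (x + y) q = baer_act x (baer_act y q).
Proof. by have [z [n [n' ->]]] := baer_mkP q; rewrite !baer_actE addrA. Qed.

Lemma baer_torsor m (q r : fiber baer_pi m) : exists! x, r = baer_act x q.
Proof.
have [y [n [n' ->]]] := baer_mkP q; have [z [k [k' ->]]] := baer_mkP r.
have [x ->] := act_trans n k; have [x' ->] := act_trans n' k'.
have -> : baer_mk z (x • n) (x' • n') = baer_mk (z + x' + x) n n'.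
  by apply/esym/baer_mk_eq; exists x, x'; split=> //; rewrite addrK addrK.
exists (z + x' + x - y); split=> [|w]; first by rewrite baer_actE subrK.
rewrite baer_actE => /esym/baer_mk_eq[a [a' [wE na na']]].
have a0 : a = 0 by apply: (@act_inj _ _ n); rewrite coext_act0.
have a'0 : a' = 0 by apply: (@act_inj _ _ n'); rewrite coext_act0.
by rewrite wE a0 a'0 !subr0 addrK.
Qed.

Lemma baer_act_mul m m' (x : A m) (q : fiber baer_pi m) (y : A m') (r : fiber baer_pi m') :
  fiber_mul baer_piM (baer_act x q) (baer_act y r)
    = baer_act (push A (mulmC m' m) x + push A (erefl (m * m')) y)
               (fiber_mul baer_piM q r).
Proof.
have [z [n [n' ->]]] := baer_mkP q; have [w [k [k' ->]]] := baer_mkP r.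
have mE a b p1 p2 p3 q1 q2 q3 :
    fiber_mul baer_piM (@baer_mk a p1 p2 p3) (@baer_mk b q1 q2 q3) =
    baer_mk (push A (mulmC b a) p1 + push A (erefl (a * b)) q1)
      (fiber_mul (@coext_piM E) p2 q2) (fiber_mul (@coext_piM F) p3 q3).
  by apply: val_inj; exact: baer_mulE.
rewrite !baer_actE !mE baer_actE !raddfD /=; congr baer_mk.
exact: addrACA.
Qed.

Definition baer : coext :=
  Coext baer_pi_surj baer_act0 baer_actD baer_torsor baer_act_mul.

End BaerSum.

Section Groupoid.
Variables (E F : coext) (h : coext_hom E F).

Lemma hom_inj : injective h.
Proof.
move=> n k hnk; have e : coext_pi k = coext_pi n by rewrite -!(hom_pi h) hnk.
have [x kx] := act_trans (Fiber (erefl (coext_pi n))) (Fiber e).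
have x0 : x = 0.
  apply: (@act_inj _ _ (fiber_map (hom_pi h) (Fiber (erefl (coext_pi n))))).
  by apply: val_inj; rewrite coext_act0 -hom_act -kx /= hnk.
by have := congr1 val kx; rewrite x0 coext_act0 /=.
Qed.

Lemma hom_surj (k : F) : exists n, h n == k.
Proof.
have [n nk] := coext_pi_surj E (coext_pi k).
have [x kx] := act_trans (fiber_map (hom_pi h) (Fiber nk)) (Fiber (erefl (coext_pi k))).
by exists (val (x • Fiber nk)); rewrite hom_act -kx.
Qed.

Let g (k : F) : E := xchoose (hom_surj k).

Let gK k : h (g k) = k. Proof. exact/eqP/(xchooseP (hom_surj k)). Qed.

Lemma hom_inv_mor : monoid.monoid_morphism g.
Proof.
by split=> [|x y]; apply: hom_inj; rewrite ?(hom_mor h).2 ?gK ?(hom_mor h).1.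
Qed.

Lemma hom_inv_pi k : coext_pi (g k) = coext_pi k.
Proof. by rewrite -(hom_pi h) gK. Qed.

Lemma hom_inv_act m (x : A m) (k : fiber (@coext_pi F) m) :
  g (val (x • k)) = val (x • fiber_map hom_inv_pi k).
Proof.
apply: hom_inj; rewrite gK hom_act; congr (val (_ • _)).
by apply: val_inj; rewrite /= gK.
Qed.

Definition hom_inv : coext_hom F E := CoextHom hom_inv_mor hom_inv_act.

(* Every morphism of coextensions is invertible. *)
Lemma hom_isomorphic : isomorphic E F.
Proof.
apply: inhabits; exists h hom_inv; apply: hom_ext => n /=; last exact: gK.
by apply: hom_inj; rewrite gK.
Qed.

End Groupoid.

Section BaerElim.
Variables (E F G : coext).
Variable b : forall m,
  fiber (@coext_pi E) m -> fiber (@coext_pi F) m -> fiber (@coext_pi G) m.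
Hypothesis b_act : forall m (x x' : A m) n n',
  b (x • n) (x' • n') = (x' + x) • b n n'.
Hypothesis b_one : val (b (Fiber (@coext_piM E).1) (Fiber (@coext_piM F).1)) = 1.
Hypothesis b_mul : forall m m'
   (n : fiber (@coext_pi E) m) (n' : fiber (@coext_pi F) m)
   (k : fiber (@coext_pi E) m') (k' : fiber (@coext_pi F) m'),
  val (b (fiber_mul (@coext_piM E) n k) (fiber_mul (@coext_piM F) n' k'))
   = val (b n n') * val (b k k').

Let f0 (t : triple E F) : G := val (tr_grp t • b (tr_fst t) (tr_snd t)).
Let f (q : baer E F) : G := f0 (repr (q : baer_type E F)).

Let fE t : f (baer_cls t) = f0 t.
Proof.
rewrite /f; set t' := repr _.
have /asboolP[x [x' ->]] : baer_rel t t' by apply/baer_clsP; rewrite /baer_cls reprK.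
rewrite /f0 /= b_act -coext_actD addrA.
by rewrite subrK subrK.
Qed.

Lemma baer_elim_mor : monoid.monoid_morphism f.
Proof.
split=> [|q r]; first by rewrite [LHS]fE /f0 /= coext_act0 b_one.
have [t ->] := baer_cls_surj q; have [u ->] := baer_cls_surj r.
rewrite [_ * _ in LHS]baer_mulE !fE /f0 /=.
rewrite -[RHS]/(val (fiber_mul (@coext_piM G) (tr_grp t • b (tr_fst t) (tr_snd t))
  (tr_grp u • b (tr_fst u) (tr_snd u)))) coext_act_mul.
by congr (val (_ • _)); apply: val_inj; rewrite b_mul.
Qed.

Lemma baer_elim_pi q : coext_pi (f q) = coext_pi q.
Proof.
have [t ->] := baer_cls_surj q.
by rewrite fE /f0 fiberP [RHS]baer_piE.
Qed.

Lemma baer_elim_act m (x : A m) (q : fiber (@coext_pi (baer E F)) m) :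
  f (val (x • q)) = val (x • fiber_map baer_elim_pi q).
Proof.
have [y [n [n' ->]]] := baer_mkP q.
have -> : x • (baer_mk y n n' : fiber (@coext_pi (baer E F)) m)
    = baer_mk (x + y) n n' by exact: baer_actE.
rewrite [LHS]fE /f0 /= coext_actD.
by congr (val (_ • _)); apply: val_inj; rewrite /= fE.
Qed.

Definition baer_elim : coext_hom (baer E F) G :=
  CoextHom baer_elim_mor baer_elim_act.
End BaerElim.


Section BaerLaws.

Lemma baer_isoC E F : isomorphic (baer E F) (baer F E).
Proof.
pose b m n n' : fiber (@coext_pi (baer F E)) m := @baer_mk F E m 0 n' n.
apply/hom_isomorphic/(@baer_elim E F (baer F E) b).
- move=> m x x' n n'; rewrite /b; apply/esym.
  have -> : (x' + x) • (@baer_mk F E m 0 n' n : fiber (@coext_pi (baer F E)) m)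
     = baer_mk (x' + x + 0) n' n by exact: baer_actE.
  by apply/baer_mk_eq; exists x', x; rewrite addr0 addrAC addrK subrr.
- by congr baer_cls; congr Triple; apply: val_inj.
- move=> m m' n n' k k'; rewrite [RHS]baer_mulE; congr baer_cls.
  by rewrite /tr_mul /= !raddf0 addr0.
Qed.

Lemma baer_iso E E' F F' :
  isomorphic E E' -> isomorphic F F' -> isomorphic (baer E F) (baer E' F').
Proof.
move=> [h] [k].
pose b m n n' : fiber (@coext_pi (baer E' F')) m :=
  @baer_mk E' F' m 0 (fiber_map (hom_pi h) n) (fiber_map (hom_pi k) n').
have fmE G H (l : coext_hom G H) m (x : A m) (n : fiber (@coext_pi G) m) :
   fiber_map (hom_pi l) (x • n) = x • fiber_map (hom_pi l) n.
  by apply: val_inj; rewrite -hom_act.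
apply/hom_isomorphic/(@baer_elim E F (baer E' F') b).
- move=> m x x' n n'; rewrite /b; apply/esym.
  have -> y : y • (@baer_mk E' F' m 0 (fiber_map (hom_pi h) n) (fiber_map (hom_pi k) n')
       : fiber (@coext_pi (baer E' F')) m)
     = baer_mk (y + 0) (fiber_map (hom_pi h) n) (fiber_map (hom_pi k) n')
    by exact: baer_actE.
  apply/baer_mk_eq; exists x, x'; rewrite !fmE; split=> //.
  by rewrite addr0 addrK subrr.
- congr baer_cls; congr Triple; apply: val_inj; rewrite /= ?(hom_mor h).1 //.
  by rewrite (hom_mor k).1.
- move=> m m' n n' l l'; rewrite [RHS]baer_mulE; congr baer_cls.
  rewrite /tr_mul /= !raddf0 addr0; congr Triple; apply: val_inj => /=.
    exact: (hom_mor h).2.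
  exact: (hom_mor k).2.
Qed.

Lemma baer_iso0 E : isomorphic (baer semidirect E) E.
Proof.
pose b m (u : fiber sdp_pi m) (n : fiber (@coext_pi E) m) : fiber (@coext_pi E) m :=
  cast (fiberP u) (tagged (val u)) • n.
have bE m x n : b m (sdp_mk x) n = x • n.
  by rewrite /b cast_id.
apply/hom_isomorphic/(@baer_elim semidirect E E b).
- move=> m x x' u n; have [z ->] := sdp_mkP u.
  have -> : x • (sdp_mk z : fiber (@coext_pi semidirect) m) = sdp_mk (x + z)
     by exact: sdp_actE.
  by rewrite !bE -!coext_actD; congr (_ • _); rewrite [LHS]addrC addrA.
- have -> : Fiber (@coext_piM semidirect).1 = sdp_mk (0 : A 1) by apply: val_inj.
  by rewrite bE coext_act0.
- move=> m m' u n v k; have [z ->] := sdp_mkP u; have [w ->] := sdp_mkP v.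
  have -> : fiber_mul (@coext_piM semidirect) (sdp_mk z) (sdp_mk w) =
      sdp_mk (push A (erefl (m * m')) w + push A (mulmC m' m) z)
    by apply: val_inj.
  rewrite !bE -[RHS]/(val (fiber_mul (@coext_piM E) (z • n) (w • k))) coext_act_mul.
  by rewrite addrC.
Qed.

(* Inverse for the Baer sum: E with the action (x, n) |-> (- x) • n. *)
Section Opposite.
Variable E : coext.

Let opp_act m (x : A m) (n : fiber (@coext_pi E) m) := (- x) • n.

Let opp_act0 m n : @opp_act m 0 n = n.
Proof. by rewrite /opp_act oppr0 coext_act0. Qed.

Let opp_actD m x y n : @opp_act m (x + y) n = opp_act x (opp_act y n).
Proof. by rewrite /opp_act opprD coext_actD. Qed.

Let opp_torsor m (n n' : fiber (@coext_pi E) m) : exists! x, n' = opp_act x n.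
Proof.
have [x ->] := act_trans n n'; exists (- x).
by split=> [|y]; rewrite /opp_act ?opprK // => /act_inj ->; rewrite opprK.
Qed.

Let opp_act_mul m m' (x : A m) (n : fiber (@coext_pi E) m)
      (y : A m') (n' : fiber (@coext_pi E) m') :
    fiber_mul (@coext_piM E) (opp_act x n) (opp_act y n')
      = opp_act (push A (mulmC m' m) x + push A (erefl (m * m')) y)
                  (fiber_mul (@coext_piM E) n n').
Proof. by rewrite /opp_act coext_act_mul opprD !raddfN. Qed.

Definition coext_opp : coext :=
  Coext (@coext_pi_surj E) opp_act0 opp_actD opp_torsor opp_act_mul.
End Opposite.

Lemma diff_subproof E m (n n' : fiber (@coext_pi E) m) : exists x, n == x • n'.
Proof. by have [x ->] := act_trans n' n; exists x. Qed.

Definition diff E m (n n' : fiber (@coext_pi E) m) : A m :=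
  xchoose (diff_subproof n n').

Lemma diffE E m (n : fiber (@coext_pi E) m) x : diff (x • n) n = x.
Proof. exact/esym/act_inj/eqP/(xchooseP (diff_subproof (x • n) n)). Qed.

Lemma baer_isoN E : isomorphic (baer (coext_opp E) E) semidirect.
Proof.
pose b m (n : fiber (@coext_pi E) m) (n' : fiber (@coext_pi E) m) :
  fiber (@coext_pi semidirect) m := sdp_mk (diff n' n).
apply/hom_isomorphic/(@baer_elim (coext_opp E) E semidirect b).
- move=> m x x' n n'; rewrite [RHS]sdp_actE; congr sdp_mk.
  have key (k k' : fiber (@coext_pi E) m) :
      diff (x' • k') ((- x) • k) = x' + x + diff k' k.
    have [d ->] := act_trans k k'; rewrite diffE.
    have -> : x' • d • k = (x' + x + d) • (- x) • k.
      by rewrite -!coext_actD addrAC addrK.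
    by rewrite diffE.
  exact: key.
- have dE (u : fiber (@coext_pi E) 1) : diff u u = 0.
    by rewrite -[X in diff X _]coext_act0 diffE.
  by rewrite /b dE.
- move=> m m' n n' k k'.
  have [d ->] := act_trans n n'; have [e ->] := act_trans k k'.
  by rewrite coext_act_mul /b !diffE /= addrC.
Qed.

Section Assoc.
Variables E F G : coext.

Let T m := fiber (@coext_pi (baer E (baer F G))) m.

Let c m (y : A m) n k l : T m := @baer_mk E (baer F G) m y n (@baer_mk F G m 0 k l).

Let exb m (q : fiber (@coext_pi (baer E F)) m) (l : fiber (@coext_pi G) m) :
  exists r : T m, exists y n k, q = @baer_mk E F m y n k /\ r = c y n k l.
Proof. by have [y [n [k qE]]] := baer_mkP q; exists (c y n k l), y, n, k. Qed.

Let b m q l : T m := projT1 (cid (@exb m q l)).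

Let actE E' F' m x (y : A m) n k :
  x • (@baer_mk E' F' m y n k : fiber (@coext_pi (baer E' F')) m)
    = @baer_mk E' F' m (x + y) n k.
Proof. exact: baer_actE. Qed.

Let bE m y n k l : b (@baer_mk E F m y n k) l = c y n k l.
Proof.
rewrite /b; case: cid => r /= [y' [n' [k' [/baer_mk_eq[x [x' [-> -> ->]]] ->]]]].
apply/esym/baer_mk_eq; exists x, x'; split=> //; rewrite actE addr0.
apply/esym/baer_mk_eq; exists x', 0.
by rewrite coext_act0 subr0 subrr.
Qed.

Lemma baer_isoA : isomorphic (baer (baer E F) G) (baer E (baer F G)).
Proof.
apply/hom_isomorphic/(@baer_elim (baer E F) G (baer E (baer F G)) b).
- move=> m x x' q l; have [y [n [k ->]]] := baer_mkP q.
  rewrite actE !bE actE; apply/esym/baer_mk_eq; exists 0, x'.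
  rewrite coext_act0 actE addr0; split=> //.
    by rewrite subr0 -(addrA x') [RHS]addrC addKr.
  apply/esym/baer_mk_eq; exists 0, x'.
  by rewrite coext_act0 subr0 subrr.
- have -> : Fiber (@coext_piM (baer E F)).1 =
     baer_mk 0 (Fiber (@coext_piM E).1) (Fiber (@coext_piM F).1) by apply: val_inj.
  by rewrite bE; congr baer_cls; congr Triple; apply: val_inj.
- move=> m m' q l r l'; have [y [n [k ->]]] := baer_mkP q.
  have [y' [n' [k' ->]]] := baer_mkP r.
  have mE E' F' a a' p1 p2 p3 q1 q2 q3 :
    fiber_mul (@coext_piM (baer E' F')) (@baer_mk E' F' a p1 p2 p3) (@baer_mk E' F' a' q1 q2 q3) =
    baer_mk (push A (mulmC a' a) p1 + push A (erefl (a * a')) q1)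
      (fiber_mul (@coext_piM E') p2 q2) (fiber_mul (@coext_piM F') p3 q3).
    by apply: val_inj; exact: baer_mulE.
  rewrite mE !bE [RHS]baer_mulE; congr baer_cls.
  by rewrite /tr_mul /= mE !raddf0 addr0.
Qed.
End Assoc.

End BaerLaws.

Section Pi0.

(* [pi0] lies in a universe above the carriers of [zmodType]s, so it cannot be
   a [zmodType] itself; the group laws for the Baer sum are [pi0_addA],
   [pi0_addC], [pi0_add0] and [pi0_addN] below. *)
Definition pi0 := {C : coext -> Prop | exists E, C = isomorphic E}.

Definition pi0_cls E : pi0 := exist _ (isomorphic E) (ex_intro _ E erefl).

Lemma isomorphic_refl E : isomorphic E E.
Proof. exact: (inhabits (iso_id E)). Qed.

Lemma isomorphic_sym E F : isomorphic E F -> isomorphic F E.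
Proof. by case=> h; exact: (inhabits (iso_sym h)). Qed.

Lemma isomorphic_trans E F G :
  isomorphic E F -> isomorphic F G -> isomorphic E G.
Proof. by case=> h [k]; exact: (inhabits (iso_comp k h)). Qed.

Lemma pi0_clsP E F : pi0_cls E = pi0_cls F <-> isomorphic E F.
Proof.
split=> [/(congr1 sval) /= EF|EF].
  by rewrite EF; exact: isomorphic_refl.
apply: eq_exist => /=; apply: functional_extensionality_dep => G.
apply: propext; split; apply: isomorphic_trans => //.
exact: isomorphic_sym.
Qed.

Definition pi0_repr (X : pi0) : coext := projT1 (cid (svalP X)).

Lemma pi0_reprK X : pi0_cls (pi0_repr X) = X.
Proof. by rewrite /pi0_repr; case: cid => E /=; case: X => C p /= XE; exact: eq_exist. Qed.

Definition pi0_zero : pi0 := pi0_cls semidirect.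
Definition pi0_add (X Y : pi0) : pi0 := pi0_cls (baer (pi0_repr X) (pi0_repr Y)).
Definition pi0_opp (X : pi0) : pi0 := pi0_cls (coext_opp (pi0_repr X)).

Lemma pi0_addE E F : pi0_add (pi0_cls E) (pi0_cls F) = pi0_cls (baer E F).
Proof.
by apply/pi0_clsP/baer_iso; apply/pi0_clsP; exact: pi0_reprK.
Qed.

Lemma pi0_addC : commutative pi0_add.
Proof. by move=> X Y; apply/pi0_clsP/baer_isoC. Qed.
Lemma pi0_addA : associative pi0_add.
Proof.
move=> X Y Z; rewrite -(pi0_reprK X) -(pi0_reprK Y) -(pi0_reprK Z) !pi0_addE.
exact/pi0_clsP/isomorphic_sym/baer_isoA.
Qed.
Lemma pi0_add0 : left_id pi0_zero pi0_add.
Proof.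
by move=> X; rewrite -(pi0_reprK X) pi0_addE; apply/pi0_clsP/baer_iso0.
Qed.
Lemma pi0_addN : left_inverse pi0_zero pi0_opp pi0_add.
Proof.
by move=> X; rewrite -{2}(pi0_reprK X) pi0_addE; apply/pi0_clsP/baer_isoN.
Qed.

End Pi0.

Definition pi1 := Aut semidirect.
HB.instance Definition _ := monoid.Group.on pi1.

End Coextensions.

(* Main.v *)
Require Import Defs.
From mathcomp Require Import all_boot all_algebra.
From HB Require Import structures.
From mathcomp Require Import boolp.

Set Implicit Arguments.
Unset Strict Implicit.
Unset Printing Implicit Defensive.

Import GRing.Theory.
Local Open Scope ring_scope.

Local Notation "x • n" := (coext_act x n) (at level 42, right associativity).
Local Notation fib E m := (fiber (@coext_pi _ _ E) m).
Local Notation fmul := (fiber_mul (@coext_piM _ _ _)).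

(** The theorem rests on two ways of reading off group elements from a
coextension [E], using that each fibre is a torsor.

Objects.  Choose a point [s m] in every fibre.  Then [s a * s b] and
[s (a * b)] lie in the same fibre and differ by a unique [f a b] in
[A (a * b)]; commutativity of [E] makes [f] symmetric, and associativity makes
it a cocycle.  Replacing [s] by [g m • s m] adds [d0_fun g] to [f], and
carrying [s] along an isomorphism leaves [f] unchanged, so the class of [f]
depends on the isomorphism class of [E] only.  Conversely, coextensions having
sections with the same [f] are isomorphic by matching the sections
([factor_set_hom]); hence the class of [f] determines [E] up to isomorphism
([isomorphicP]).  Every cocycle occurs, as it can be used to twist the product
of the semidirect product ([classifies_twisted]).  Products of sections show
that Baer sums go to sums ([classifies_baer]), and the section
[m |-> (m, 0)] of the semidirect product has [f = 0].

Morphisms.  An endomorphism of [E] preserves each fibre and commutes with the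
action of an abelian group that is transitive there, so it acts on the fibre
over [m] as a single translation [g m].  Multiplicativity says exactly that
[d0 g = 0].  This works for every [E], not just for the split coextension, and
composition of translations is addition ([Aut_D0]). *)

(** * Factor sets of sections *)

(** Multiplicative maps of monoids need not preserve the unit; the maps between
coextensions below do, because the unit is one of their values. *)
Lemma mul_map_unit (N N' : comMonoidType) (h : N -> N') n :
  (forall x y, h (x * y)%g = (h x * h y)%g) -> h n = 1%g -> h 1%g = 1%g.
Proof. by move=> hM hn; rewrite -[LHS]mulg1 -hn -hM mul1g. Qed.

Section Sections.
Variables (M : comMonoidType) (A : system M).
Implicit Types (E F : coext A) (f : fun2 A) (g : C0 A).

(** Points of fibres over [a] and [b] are compared in the total monoid, so that
equations of [M] enter only through a [cast] on the acting element. *)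
Lemma val_act_cast E a b (e : a = b) (x : A a) (n : fib E a) (n' : fib E b) :
  val n = val n' -> val (cast e x • n') = val (x • n).
Proof. by case: b / e n' => n' /val_inj->. Qed.

Lemma hom_act_fiber E F (h : coext_hom E F) m (x : A m) (n : fib E m) :
  fiber_map (hom_pi h) (x • n) = x • fiber_map (hom_pi h) n.
Proof. by apply: val_inj; rewrite /= hom_act. Qed.

Definition factor_set E (s : forall m, fib E m) f : Prop :=
  forall a b, fmul (s a) (s b) = f a b • s (a * b)%g.

(** A relation instead of a function of [E]: it hides the choice of a section,
so that [z] matters only up to coboundaries. *)
Definition classifies E (z : Z1 A) : Prop :=
  exists s : forall m, fib E m, factor_set s (val (val z)).

Lemma factor_set_sym E (s : forall m, fib E m) f :
  factor_set s f -> f \in @C1_pred M A.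
Proof.
move=> sf; rewrite inE; apply/asboolP => a b.
apply: (@act_inj _ _ E _ (s (a * b)%g)); apply: val_inj.
rewrite -sf (@val_act_cast _ _ _ _ _ (s (b * a)%g)); last by rewrite mulmC.
by rewrite -sf /= mulmC.
Qed.

(** Both bracketings of [s a * s b * s c] lie in the orbit of [s (a * b * c)];
equating the elements of [A (a * b * c)] that carry [s (a * b * c)] there gives
the cocycle equation. *)
Lemma factor_set_cocycle E (s : forall m, fib E m) f a b c :
  factor_set s f -> d1_fun f a b c = 0.
Proof.
move=> sf; set abc := (a * b * c)%g.
(* The bare factor is written as [0 • _], so that the product rule applies. *)
have mulL : fmul (fmul (s a) (s b)) (s c)
    = (push A (mulmC c (a * b)%g) (f a b) + f (a * b)%g c) • s abc.
  by rewrite sf -[s c]coext_act0 coext_act_mul sf raddf0 addr0 coext_actD.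
have mulR : fmul (s a) (fmul (s b) (s c))
    = (push A (erefl (a * (b * c))%g) (f b c) + f a (b * c)%g) • s (a * (b * c))%g.
  by rewrite sf -[s a]coext_act0 coext_act_mul raddf0 add0r coext_actD sf.
have mulLR : push A (mulmC c (a * b)%g) (f a b) + f (a * b)%g c
    = push A (mulgA a b c) (f b c) + cast (mulgA a b c) (f a (b * c)%g).
  apply: (@act_inj _ _ E _ (s abc)); apply: val_inj; rewrite -mulL.
  rewrite (push_eq a (mulgA a b c) (etrans erefl (mulgA a b c))) // -cast_push -raddfD /=.
  rewrite (@val_act_cast _ _ _ _ _ (s (a * (b * c))%g)) ?mulgA // -mulR /=.
  by rewrite mulgA.
by rewrite /d1_fun [X in X - _]addrAC -mulLR addrK subrr.
Qed.

Lemma classified E : exists z, classifies E z.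
Proof.
have sP m : exists n : fib E m, True.
  by have [n nm] := coext_pi_surj E m; exists (Fiber nm).
pose s m : fib E m := projT1 (cid (sP m)).
pose f : fun2 A := fun a b =>
  projT1 (cid (act_trans (s (a * b)%g) (fmul (s a) (s b)))).
have sf : factor_set s f by move=> a b; rewrite /f; case: cid.
have kf : MkC1 (factor_set_sym sf) \in ker_pred (@d1 M A).
  rewrite inE; apply/eqP/val_inj.
  by do 3 apply: functional_extensionality_dep => ?; apply: (factor_set_cocycle _ _ _ sf).
by exists (Ker kf), s.
Qed.

Lemma factor_set_translate E (s : forall m, fib E m) f g :
  factor_set s f -> factor_set (fun m => g m • s m) (f + d0_fun g).
Proof.
move=> sf a b; rewrite coext_act_mul sf -!coext_actD.
congr (_ • _); rewrite -[(f + d0_fun g) a b]/(f a b + (_ - _ + _)) !addrA.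
by rewrite [RHS](ACl ((4*2*1)*(3*5)))%AC /= addNr addr0.
Qed.

Lemma factor_set_inj E (s : forall m, fib E m) f f' :
  factor_set s f -> factor_set s f' -> f = f'.
Proof.
move=> sf sf'; apply: functional_extensionality_dep => a.
apply: functional_extensionality_dep => b.
by apply: (@act_inj _ _ E _ (s (a * b)%g)); rewrite -sf -sf'.
Qed.

Lemma factor_set_map E F (h : coext_hom E F) (s : forall m, fib E m) f :
  factor_set s f -> factor_set (fun m => fiber_map (hom_pi h) (s m)) f.
Proof.
move=> sf a b; rewrite -hom_act_fiber -sf; apply: val_inj => /=.
by rewrite (hom_mor h).2.
Qed.

Lemma classifies_semidirect : classifies (semidirect A) 0.
Proof.
exists (fun m => sdp_mk (0 : A m)) => a b.
rewrite coext_act0; apply: val_inj => /=.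
by rewrite -[LHS]/(sdp_pair (_ + _)) !raddf0 addr0.
Qed.

(** For sections [s] and [t] with cocycles [z] and [w], the section
[m |-> [0, s m, t m]] has cocycle [z + w]: the relation defining the Baer sum
moves the group elements produced by both products into the first entry. *)
Lemma classifies_baer E F z w :
  classifies E z -> classifies F w -> classifies (baer E F) (z + w).
Proof.
move=> [s sz] [t tw]; exists (fun m => baer_mk 0 (s m) (t m)) => a b.
set f := val (val z); set g := val (val w).
have -> : (val (val (z + w))) a b = f a b + g a b by [].
rewrite [RHS]baer_actE addr0.
transitivity (baer_mk 0 (fmul (s a) (s b)) (fmul (t a) (t b))).
  apply: val_inj; rewrite [LHS]baer_mulE; congr baer_cls.
  by rewrite /tr_mul /= !raddf0 addr0.
rewrite sz tw; apply/esym/baer_mk_eq; exists (f a b), (g a b).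
by rewrite [X in X - _]addrAC subrr add0r subrr.
Qed.

(** * Isomorphism classes and cohomologous factor sets *)

Section SameFactors.
Variables (E F : coext A) (s : forall m, fib E m) (t : forall m, fib F m).
Variable f : fun2 A.
Hypotheses (sf : factor_set s f) (tf : factor_set t f).

(** The morphism is [x • s m |-> x • t m]; it is multiplicative because the
products of the [s m] and of the [t m] are governed by the same [f]. *)
Lemma factor_set_hom : inhabited (coext_hom E F).
Proof.
pose h (n : E) : F :=
  val (diff (Fiber (erefl (coext_pi n))) (s (coext_pi n)) • t (coext_pi n)).
have hE m (x : A m) : h (val (x • s m)) = val (x • t m).
  have hfib n m' (e : coext_pi n = m') : h n = val (diff (Fiber e) (s m') • t m').
    by case: m' / e.
  rewrite (hfib _ _ (fiberP (x • s m))).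
  have -> : Fiber (fiberP (x • s m)) = x • s m by apply: val_inj.
  by rewrite diffE.
have sP n : exists x : A (coext_pi n), n = val (x • s (coext_pi n)).
  by have [x xs] := act_trans (s (coext_pi n)) (Fiber erefl); exists x; rewrite -xs.
have hM n n' : h (n * n')%g = (h n * h n')%g.
  have [x ->] := sP n; have [x' ->] := sP n'; move: (coext_pi n) (coext_pi n') x x'.
  move=> m m' x x'; rewrite !hE.
  rewrite -[X in h X]/(val (fmul (x • s m) (x' • s m'))).
  rewrite -[RHS]/(val (fmul (x • t m) (x' • t m'))).
  by rewrite !coext_act_mul sf tf -!coext_actD hE.
have h1 : h 1%g = 1%g.
  have [x xt] := act_trans (t 1%g) (Fiber (@coext_piM _ _ F).1).
  have h1x : h (val (x • s 1%g)) = 1%g by rewrite hE -xt.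
  exact: mul_map_unit hM h1x.
have hpi n : coext_pi (h n) = coext_pi n by exact: fiberP.
have hact m (x : A m) (n : fib E m) : h (val (x • n)) = val (x • fiber_map hpi n).
  have [y ny] := act_trans (s m) n.
  rewrite ny -coext_actD hE coext_actD; congr (val (_ • _)); apply: val_inj.
  by rewrite /= hE.
exact: (inhabits (@CoextHom _ _ E F h (conj h1 hM) hpi hact)).
Qed.

End SameFactors.

Lemma factor_set_cohomologous E (s t : forall m, fib E m) f f' :
  factor_set s f -> factor_set t f' -> exists g, f = f' + d0_fun g.
Proof.
move=> sf tf.
exists (fun m => projT1 (cid (act_trans (t m) (s m)))).
set g := fun m => _; apply: factor_set_inj sf _.
suff -> : s = fun m => g m • t m by exact: factor_set_translate.
by apply: functional_extensionality_dep => m; rewrite /g; case: cid.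
Qed.

Lemma mem_B1 (z w : Z1 A) :
  (z - w \in @B1_pred M A) <->
  exists g : C0 A, val (val z) = val (val w) + d0_fun g.
Proof.
rewrite inE; split=> [/asboolP[g gE]|[g gE]]; last apply/asboolP; exists g.
  have -> : d0_fun g = val (val z) - val (val w) by rewrite -[LHS]/(val (d0 g)) gE.
  by rewrite addrC subrK.
apply: val_inj; rewrite -[RHS]/(val (val z) - val (val w)) gE.
by rewrite addrC addKr.
Qed.

(** An isomorphism carries a section of [E] with cocycle [z] to a section of [F]
with the same cocycle, where it can be compared with one of cocycle [w].
Conversely, translating the section of [F] turns [w] into [z]. *)
Lemma isomorphicP E F z w : classifies E z -> classifies F w ->
  isomorphic E F <-> z - w \in @B1_pred M A.
Proof.
move=> [s sz] [t tw]; split=> [[h]|/mem_B1[g zw]].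
  exact/mem_B1/(factor_set_cohomologous (factor_set_map h sz) tw).
have tz := factor_set_translate g tw; rewrite -zw in tz.
by have [h] := factor_set_hom sz tz; exact: hom_isomorphic h.
Qed.

End Sections.

(** * The coextension of a cocycle *)

Section Twisted.
Variables (M : comMonoidType) (A : system M) (z : Z1 A).

Let f : fun2 A := val (val z).

Let fC a b : f a b = cast (mulmC b a) (f b a).
Proof. by move: a b; apply/asboolP; exact: (valP (val z)). Qed.

Let fZ a b c :
  push A (mulgA a b c) (f b c) + cast (mulgA a b c) (f a (b * c)%g)
    = push A (mulmC c (a * b)%g) (f a b) + f (a * b)%g c.
Proof.
have /eqP/(congr1 val) := valP z.
move=> /(congr1 (fun h : fun3 A => h a b c)).
rewrite -[LHS]/(d1_fun f a b c) /d1_fun -[RHS]/(0 : A (a * b * c)%g) => fz.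
by rewrite -(subr0_eq fz) [X in _ = X + _]addrAC subrK.
Qed.

(** A copy of [sdp A], so that the twisted product does not compete with that of
the semidirect product.  The fibres and the action are those of the semidirect
product. *)
Definition twisted : Type := sdp A.
HB.instance Definition _ := Choice.on twisted.

Definition twisted_mul (u v : twisted) : twisted :=
  sdp_pair (push A (erefl (tag u * tag v)%g) (tagged v)
    + push A (mulmC (tag v) (tag u)) (tagged u) + f (tag u) (tag v)).

(** Cocycles are not assumed normalized: [(1, 0)] times itself is
[(1, f 1 1)], so the unit is [(1, - f 1 1)]. *)
Definition twisted_one : twisted :=
  sdp_pair (cast (mul1g 1%g) (- f 1%g 1%g)).

Lemma twisted_mulA : associative twisted_mul.
Proof.
move=> [a x] [b y] [c t]; rewrite /twisted_mul /=; apply: (sdp_eq (e := mulgA a b c)).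
rewrite !raddfD /= !cast_push !push_push.
rewrite (push_eq a (etrans erefl (mulgA a b c)) (mulgA a b c)) //.
rewrite [X in X + _]addrAC -[LHS]addrA fZ !addrA.
by congr (_ + _ + _ + _ + _); apply: push_eq; rewrite // mulmC.
Qed.

Lemma twisted_mulC : commutative twisted_mul.
Proof.
move=> [a x] [b y]; rewrite /twisted_mul /=; apply: (sdp_eq (e := mulmC a b)).
rewrite !raddfD /= !cast_push -fC.
by congr (_ + _); rewrite addrC; congr (_ + _); apply: push_eq.
Qed.

(** The cocycle equation at [(1, 1, a)], where two of the four terms cancel:
[f 1 a] is determined by [f 1 1], which is what the unit law needs. *)
Lemma twisted_f1 a (e : (1 * a)%g = a) (e' : (a * (1 * 1))%g = a) :
  cast e (f 1%g a) = push A e' (f 1%g 1%g).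
Proof.
have e3 : (1 * 1 * a)%g = a by rewrite !mul1g.
have := congr1 (cast e3) (fZ 1%g 1%g a); rewrite !raddfD /= !cast_push cast_cast.
have -> : cast e3 (f (1 * 1)%g a) = cast e (f 1%g a).
  rewrite -(cast_app1 f (congr1 (monoid.mul^~ a) (mul1g 1%g)) (mul1g 1%g)) cast_cast.
  by congr cast; apply: eq_irrelevance.
have -> : cast (etrans (mulgA 1%g 1%g a) e3) (f 1%g (1 * a)%g) = cast e (f 1%g a).
  rewrite -(cast_app2 f (congr1 (monoid.mul 1%g) e) e) cast_cast.
  by congr cast; apply: eq_irrelevance.
move/addIr; rewrite castE => fa; apply: etrans (etrans fa _); exact: push_eq.
Qed.

Lemma twisted_mul1 : left_id twisted_one twisted_mul.
Proof.
move=> [a x]; rewrite /twisted_mul /=; apply: (sdp_eq (e := mul1g a)).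
rewrite !raddfD /= !cast_push push1 push_cast raddfN /= -(twisted_f1 (mul1g a)).
by rewrite -addrA addNr addr0.
Qed.

Lemma twisted_mulr1 : right_id twisted_one twisted_mul.
Proof. by move=> u; rewrite twisted_mulC twisted_mul1. Qed.

HB.instance Definition _ :=
  isMonoid.Build twisted twisted_mulA twisted_mul1 twisted_mulr1.
HB.instance Definition _ := Monoid_isCommutative.Build twisted twisted_mulC.

Definition twisted_pi (u : twisted) : M := tag u.

Lemma twisted_piM : monoid.monoid_morphism twisted_pi.
Proof. by []. Qed.

Lemma twisted_act_mul m m' (x : A m) (u : fiber twisted_pi m)
      (y : A m') (v : fiber twisted_pi m') :
    fiber_mul twisted_piM (sdp_act x u) (sdp_act y v)
      = sdp_act (push A (mulmC m' m) x + push A (erefl (m * m')%g) y)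
                  (fiber_mul twisted_piM u v).
Proof.
have [p ->] := sdp_mkP u; have [q ->] := sdp_mkP v.
have mE a b p' q' : fiber_mul twisted_piM (@sdp_mk _ _ a p') (@sdp_mk _ _ b q') =
   sdp_mk (push A (erefl (a * b)%g) q' + push A (mulmC b a) p' + f a b)
  by apply: val_inj.
rewrite !sdp_actE !mE sdp_actE !raddfD /=; congr sdp_mk.
rewrite [RHS]addrA; congr (_ + _).
by rewrite [LHS]addrACA; congr (_ + _); apply: addrC.
Qed.

Definition twisted_coext : coext A :=
  @Coext M A twisted twisted_pi twisted_piM (@sdp_pi_surj M A) (@sdp_act M A)
    (@sdp_act0 M A) (@sdp_actD M A) (@sdp_torsor M A) twisted_act_mul.

Lemma classifies_twisted : classifies twisted_coext z.
Proof.
exists (fun m => sdp_mk (0 : A m)) => a b.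
rewrite [RHS]sdp_actE addr0; apply: val_inj => /=.
by rewrite -[LHS]/(sdp_pair (_ + _)) !raddf0 addr0 add0r.
Qed.

End Twisted.

(** * Automorphisms *)

Section Automorphisms.
Variables (M : comMonoidType) (A : system M) (E : coext A).
Implicit Types (g : D0 A) (h k : coext_hom E E).

Definition translates g h : Prop :=
  forall m (n : fib E m), h (val n) = val (val g m • n).

Lemma D0_mul g a b : val g (a * b)%g
  = push A (mulmC b a) (val g a) + push A (erefl (a * b)%g) (val g b).
Proof.
have /eqP/(congr1 val)/(congr1 (fun f : fun2 A => f a b)) := valP g.
rewrite -[LHS]/(d0_fun (val g) a b) -[RHS]/(0 : A (a * b)%g) /d0_fun => g0.
apply/esym/subr0_eq; rewrite -g0 [RHS]addrAC; congr (_ - _); exact: addrC.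
Qed.

(** Over [m] the morphism moves one point by some [x].  It moves [y • n] to
[y • x • n], which is [x • y • n] because [A m] is abelian, so the same [x]
serves the whole fibre. *)
Lemma translates_exists h : exists g, translates g h.
Proof.
have gP m : exists x : A m, forall n : fib E m, h (val n) = val (x • n).
  have [n0 n0m] := coext_pi_surj E m; pose n1 : fib E m := Fiber n0m.
  have [x hx] := act_trans n1 (fiber_map (hom_pi h) n1); exists x => n.
  have [y ->] := act_trans n1 n.
  by rewrite hom_act hx -!coext_actD addrC.
pose g : C0 A := fun m => projT1 (cid (gP m)).
have gE m (n : fib E m) : h (val n) = val (g m • n).
  by rewrite /g; case: cid => x /= ->.
suff kg : g \in ker_pred (@d0 M A) by exists (Ker kg).
rewrite inE; apply/eqP/val_inj; apply: functional_extensionality_dep => a.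
apply: functional_extensionality_dep => b.
rewrite -[LHS]/(d0_fun g a b) -[RHS]/(0 : A (a * b)%g) /d0_fun.
have [n na] := coext_pi_surj E a; have [n' nb] := coext_pi_surj E b.
rewrite addrAC; apply/eqP; rewrite subr_eq0 addrC; apply/eqP.
pose u : fib E a := Fiber na; pose v : fib E b := Fiber nb.
apply: (@act_inj _ _ E _ (fmul u v)); apply: val_inj.
by rewrite -coext_act_mul -gE /= -gE -gE (hom_mor h).2.
Qed.

Lemma translates_hom g : exists h, translates g h.
Proof.
pose h (n : E) : E := val (val g (coext_pi n) • Fiber (erefl (coext_pi n))).
have hE m (n : fib E m) : h (val n) = val (val g m • n).
  have hfib n' (e : coext_pi n' = m) : h n' = val (val g m • Fiber e).
    by case: m / e {n}.
  by rewrite (hfib _ (fiberP n)); congr (val (_ • _)); apply: val_inj.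
have hM n n' : h (n * n')%g = (h n * h n')%g.
  pose u : fib E (coext_pi n) := Fiber erefl.
  pose v : fib E (coext_pi n') := Fiber erefl.
  rewrite -[LHS]/(h (val (fmul u v))) hE D0_mul -coext_act_mul.
  by rewrite /= -!hE.
have h1 : h 1%g = 1%g.
  pose u : fib E 1%g := Fiber (@coext_piM _ _ E).1.
  have [x xu] := act_trans (val g 1%g • u) u.
  have h1x : h (val (x • u)) = 1%g.
    by rewrite hE -coext_actD addrC coext_actD -xu.
  exact: mul_map_unit hM h1x.
have hpi n : coext_pi (h n) = coext_pi n by exact: fiberP.
have hact m (x : A m) (n : fib E m) : h (val (x • n)) = val (x • fiber_map hpi n).
  rewrite hE -coext_actD addrC coext_actD; congr (val (_ • _)).
  by apply: val_inj; rewrite /= hE.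
by exists (@CoextHom _ _ E E h (conj h1 hM) hpi hact).
Qed.

Lemma translates_fun g h k : translates g h -> translates g k -> h = k.
Proof.
by move=> gh gk; apply: hom_ext => n; rewrite -[n]/(val (Fiber (erefl (coext_pi n)))) gh gk.
Qed.

Lemma translates_inj g g' h : translates g h -> translates g' h -> g = g'.
Proof.
move=> gh gh'; apply: val_inj; apply: functional_extensionality_dep => m.
have [n nm] := coext_pi_surj E m.
by apply: (@act_inj _ _ E _ (Fiber nm)); apply: val_inj; rewrite -gh -gh'.
Qed.

Lemma translates_comp g g' h k :
  translates g h -> translates g' k -> translates (g + g') (hom_comp h k).
Proof.
by move=> gh gk m n; rewrite /= gk gh -coext_actD.
Qed.

Lemma translates_id : translates 0 (hom_id E).
Proof. by move=> m n; rewrite coext_act0. Qed.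

Lemma translates_Aut g : exists k : Aut E, translates g k.
Proof.
have [h gh] := translates_hom g; have [k gk] := translates_hom (- g).
have hk : hom_comp h k = hom_id E.
  apply: translates_fun (translates_comp gh gk) _; rewrite subrr.
  exact: translates_id.
have kh : hom_comp k h = hom_id E.
  apply: translates_fun (translates_comp gk gh) _; rewrite addNr.
  exact: translates_id.
by exists (CoextIso kh hk).
Qed.

Lemma Aut_D0 : exists psi : Aut E -> D0 A,
  bijective psi /\ forall h k : Aut E, psi (h * k)%g = psi h + psi k.
Proof.
pose psi (h : Aut E) := projT1 (cid (translates_exists h)).
have psiP (h : Aut E) : translates (psi h) h by rewrite /psi; case: cid.
pose aut g := projT1 (cid (translates_Aut g)).
have autP g : translates g (aut g) by rewrite /aut; case: cid.
exists psi; split=> [|h k].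
  exists aut => [h|g]; last exact: translates_inj (psiP _) (autP g).
  exact: iso_ext (translates_fun (autP _) (psiP h)).
exact: (translates_inj (psiP (h * k)%g) (translates_comp (psiP h) (psiP k))).
Qed.

End Automorphisms.

(** * The isomorphisms *)

Theorem corollary4p5 (M : comMonoidType) (A : system M) :
  (exists phi : pi0 A -> D1 A,
     [/\ bijective phi,
         forall X Y : pi0 A, phi (pi0_add X Y) = phi X + phi Y
       & phi (pi0_cls (semidirect A)) = 0])
  /\
  (exists psi : pi1 A -> D0 A,
     bijective psi /\ forall h k : pi1 A, psi (h * k)%g = psi h + psi k).
Proof.
split; last exact: Aut_D0.
pose phi X : D1 A := \pi_(D1 A)%qT (projT1 (cid (classified (pi0_repr X)))).
have phiE E z : classifies E z -> phi (pi0_cls E) = \pi_(D1 A)%qT z.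
  move=> Ez; rewrite /phi; case: cid => w /= wE.
  apply/eqP; rewrite -Quotient.idealrBE; apply/(isomorphicP wE Ez).
  by apply/pi0_clsP; rewrite pi0_reprK.
have phi_inj X Y : phi X = phi Y -> X = Y.
  rewrite -(pi0_reprK X) -(pi0_reprK Y).
  have [z Xz] := classified (pi0_repr X); have [w Yw] := classified (pi0_repr Y).
  rewrite (phiE _ _ Xz) (phiE _ _ Yw) => /eqP; rewrite -Quotient.idealrBE => zw.
  exact/pi0_clsP/(isomorphicP Xz Yw).
pose coext_of (c : D1 A) := pi0_cls (twisted_coext (repr c)).
have coext_ofK c : phi (coext_of c) = c.
  by rewrite (phiE _ _ (classifies_twisted _)) reprK.
exists phi; split=> [|X Y|].
- by exists coext_of => [X|]; [apply: phi_inj; rewrite coext_ofK|].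
- rewrite -(pi0_reprK X) -(pi0_reprK Y) pi0_addE.
  have [z Xz] := classified (pi0_repr X); have [w Yw] := classified (pi0_repr Y).
  rewrite (phiE _ _ Xz) (phiE _ _ Yw) (phiE _ _ (classifies_baer Xz Yw)).
  exact: raddfD.
rewrite (phiE _ _ (classifies_semidirect A)); exact: raddf0.
Qed.
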